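(* Let $n$ and $q$ be positive integers and let $m_1,\dots,m_q$ be integers with $1\le m_k\le n-1$ for $k=1,\dots,q$ and $\sum_{k=1}^q m_k<n$. Let $f(0),f(1),\dots,f(q)$ be positive real numbers such that either $f(0)>f(1)>\cdots>f(q)$, or there is an integer $s$ with $0\le s<q$ such that $f(0)>f(1)>\cdots>f(s)>0$ and $f(s)=f(s+1)=\cdots=f(q)$. Let $\lambda_1,\dots,\lambda_n$ be arbitrary nonzero complex numbers (not necessarily distinct). Then there exist a matrix $A\in\mathbb{C}^{n\times n}$ whose eigenvalues, counted with algebraic multiplicity, are $\lambda_1,\dots,\lambda_n$, and a vector $r_0\in\mathbb{C}^n$ with $\|r_0\|=f(0)$, such that $\|r_k\|=f(k)$ for $k=1,\dots,q$, where $r_k$ is the residual at cycle $k$ of restarted GMRES with variable restart parameter $m_k$ (that is, $m_k$ is the restart parameter used at cycle $k$) applied to the linear system $Ax=b$ with initial residual $r_0=b-Ax_0$.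
   Context: $\|\cdot\|$ is the Euclidean norm on $\mathbb{C}^n$. For $A\in\mathbb{C}^{n\times n}$, $r\in\mathbb{C}^n$ and $j\ge 1$, the Krylov subspace is $\mathcal{K}_j(A,r)=\mathrm{span}\{r,Ar,\dots,A^{j-1}r\}$, and $A\mathcal{K}_j(A,r)=\mathrm{span}\{Ar,A^2r,\dots,A^jr\}$. Restarted GMRES with variable restart parameters $m_1,\dots,m_q$, applied to $Ax=b$ with initial approximation $x_0$ and initial residual $r_0=b-Ax_0$, produces at cycle $k=1,\dots,q$ an approximation $x_k\in x_{k-1}+\mathcal{K}_{m_k}(A,r_{k-1})$ whose residual $r_k=b-Ax_k$ has minimal norm; equivalently, $r_k=r_{k-1}-u_k$ where $u_k\in A\mathcal{K}_{m_k}(A,r_{k-1})$ and $\|r_k\|=\min_{u\in A\mathcal{K}_{m_k}(A,r_{k-1})}\|r_{k-1}-u\|$ (so $r_k$ is uniquely determined by $A$, $m_k$ and $r_{k-1}$). *)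

(* Defs.v *)
From HB Require Import structures.
From mathcomp Require Import all_boot all_order all_algebra.
From mathcomp Require Import reals.
From mathcomp.real_closed Require Import complex.

Set Implicit Arguments.
Unset Strict Implicit.
Unset Printing Implicit Defensive.

Import Order.TTheory GRing.Theory Num.Theory.

Local Open Scope ring_scope.

(* The complex numbers are R[i], for an arbitrary R : realType. *)

Definition enorm (R : realType) (n : nat) (v : 'cV[R[i]]_n) : R :=
  Num.sqrt (\sum_(i < n) ComplexField.Normc.normc (v i 0) ^+ 2).

Definition krylov (R : realType) (n : nat) (A : 'M[R[i]]_n) (r : 'cV[R[i]]_n)
    (j : nat) : {vspace 'cV[R[i]]_n} :=
  <<mkseq (fun i : nat => A ^+ i *m r) j>>%VS.

Definition residual (R : realType) (n : nat) (A : 'M[R[i]]_n)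
    (b x : 'cV[R[i]]_n) : 'cV[R[i]]_n := b - A *m x.

(* x' is a minimal-residual iterate in x + K_j(A, b - A x). *)
Definition gmres_cycle (R : realType) (n : nat) (A : 'M[R[i]]_n)
    (b : 'cV[R[i]]_n) (j : nat) (x x' : 'cV[R[i]]_n) : Prop :=
  x' - x \in krylov A (residual A b x) j /\
  forall z : 'cV[R[i]]_n, z - x \in krylov A (residual A b x) j ->
    enorm (residual A b x') <= enorm (residual A b z).

(* Cycle k, for 1 <= k <= q, leads from x (k - 1) to x k with restart
   parameter m k; the values m 0 and m k, x k for k > q play no role. *)
Definition restarted_gmres (R : realType) (n : nat) (A : 'M[R[i]]_n)
    (b x0 : 'cV[R[i]]_n) (q : nat) (m : nat -> nat)
    (x : nat -> 'cV[R[i]]_n) : Prop :=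
  x 0%N = x0 /\
  forall k : nat, (1 <= k <= q)%N -> gmres_cycle A b (m k) (x k.-1) (x k).

(* Main.v *)
Require Import Defs.
From HB Require Import structures.
From mathcomp Require Import all_boot all_order all_algebra.
From mathcomp Require Import reals.
From mathcomp.real_closed Require Import complex.
From mathcomp Require boolp.

Set Implicit Arguments.
Unset Strict Implicit.
Unset Printing Implicit Defensive.

Import Order.TTheory GRing.Theory Num.Theory.

Local Open Scope ring_scope.

(** Let M k = m 1 + ... + m k be the number of matrix-vector products used
    before cycle k.+1. While the norms f(k) decrease, the construction makes
    the residual at the end of cycle k equal to D_k(A) r_0 with
    D_k = (1 - X^(m 1)) ... (1 - X^(m k)), that is, cycle k applies the
    polynomial 1 - X^(m k).

    Fix a real vector v whose entries vanish except at the positions M k, where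
    (v_(M k))^2 = f(k)^2 - f(k+1)^2, and call tail k the vector v with the
    entries before position M k erased; telescoping gives it the norm f(k).
    The polynomials P_j = X^(j - M k) D_k, for M k <= j < M k.+1, have degree j
    for every j < n, so a matrix A and a start vector r_0 may be prescribed by
    the values of the vectors P_j(A) r_0, as long as these form a basis; the
    characteristic polynomial is still free, because it concerns only the next
    vector, of degree n ([exists_mx_prescribed_orbit]). The values chosen are
      P_j(A) r_0 = tail k  when j = M k,   and   P_j(A) r_0 = e_j  otherwise,
    which is a triangular basis. Then A tail k, ..., A^(m k.+1 - 1) tail k are
    the basis vectors strictly between positions M k and M k.+1, and
    A^(m k.+1) tail k = tail k - tail k.+1 lives on position M k. Hence
    A K_(m k.+1)(A, tail k) lies in the span of positions M k to M k.+1 - 1,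
    which tail k.+1 avoids: tail k.+1 is the residual of minimal norm, and the
    only one ([gmres_cycleP]).

    Let p be the number of cycles with strict decrease. Replacing f(p+1) by 0
    makes tail p a multiple of the basis vector at position M p, and replacing
    m p.+1 by n makes A^i tail p run through the later basis vectors; these
    avoid position M p, so every cycle after p stagnates. If p = q the same
    choice just says that tail q is what remains of v. *)

(** * Matrices with a prescribed orbit and characteristic polynomial *)

Lemma char_poly_uconj (K : fieldType) (n : nat) (V A : 'M[K]_n) :
  V \in unitmx -> char_poly (V *m A *m invmx V) = char_poly A.
Proof.
move=> V_unit.
have VVi : map_mx (@polyC K) V *m map_mx (@polyC K) (invmx V) = 1%:M.
  by rewrite -map_mxM mulmxV ?map_mx1.
rewrite /char_poly.
have -> : char_poly_mx (V *m A *m invmx V)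
    = map_mx (@polyC K) V *m char_poly_mx A *m map_mx (@polyC K) (invmx V).
  rewrite /char_poly_mx mulmxBr mulmxBl !map_mxM; congr (_ - _).
  by rewrite scalar_mxC -mulmxA VVi mulmx1.
by rewrite !det_mulmx mulrAC -det_mulmx VVi det1 mul1r.
Qed.

Lemma char_poly_tr (K : fieldType) (n : nat) (A : 'M[K]_n) :
  char_poly A^T = char_poly A.
Proof.
by rewrite -[RHS]det_tr /char_poly_mx linearB /= tr_scalar_mx map_trmx.
Qed.

(** The transposed companion matrix, which shifts the basis columns. *)
Lemma exists_cyclic_mx (K : fieldType) (n : nat) (chi : {poly K}) :
  chi \is monic -> size chi = n.+2 ->
  exists C : 'M[K]_n.+1, char_poly C = chi /\
    forall i j : 'I_n.+1, j = i.+1 :> nat ->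
      C *m delta_mx i 0 = delta_mx j 0 :> 'cV_n.+1.
Proof.
move=> chi_monic size_chi; have dimE : (size chi).-1 = n.+1 by rewrite size_chi.
have charC := companionmxK chi_monic.
have := @mulmx_delta_companion _ chi.
move: (companionmx chi) charC; rewrite dimE => C charC shiftC.
exists C^T; split; first by rewrite char_poly_tr.
move=> i j ij; have i_small : (i.+1 < n.+1)%N by rewrite -ij.
apply: trmx_inj; rewrite trmx_mul trmxK !trmx_delta shiftC.
by congr delta_mx; apply: val_inj.
Qed.

(** For a matrix that shifts the basis columns, the vector p(C) e_0 is the
    coefficient vector of p, whatever the last column of C. *)
Lemma horner_cyclic_mx (K : fieldType) (n : nat) (C : 'M[K]_n.+1)
    (p : {poly K}) :
  (forall i j : 'I_n.+1, j = i.+1 :> nat ->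
     C *m delta_mx i 0 = delta_mx j 0 :> 'cV_n.+1) ->
  (size p <= n.+1)%N ->
  horner_mx C p *m delta_mx 0 0 = \col_(i < n.+1) p`_i.
Proof.
move=> shiftC size_p.
have powC (i : 'I_n.+1) : C ^+ i *m delta_mx 0 0 = delta_mx i 0 :> 'cV_n.+1.
  case: i => k; elim: k => [|k IH] lt_k /=.
    by rewrite expr0 mul1mx; congr delta_mx; apply: val_inj.
  rewrite exprS -mulmxA (IH (ltnW lt_k)).
  exact: shiftC.
rewrite -{1}(coefK p) poly_def linear_sum /= mulmx_suml.
rewrite (big_ord_widen n.+1 (fun i => horner_mx C (p`_i *: 'X^i) *m
   (delta_mx 0 0 : 'cV_n.+1))) // big_mkcond /=.
apply/colP => k; rewrite summxE (bigD1 k) //= big1 => [|i neq_ik].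
  rewrite addr0 [RHS]mxE; case: ltnP => [_|le_k]; last first.
    by rewrite mxE nth_default.
  by rewrite linearZ rmorphXn /= horner_mx_X -scalemxAl powC !mxE !eqxx mulr1.
case: ifP => _; last by rewrite mxE.
rewrite linearZ rmorphXn /= horner_mx_X -scalemxAl powC !mxE eq_sym.
by rewrite (negPf neq_ik) mulr0.
Qed.

(** The vectors P_j(A) x with deg P_j = j < n involve only A^i x for i < n,
    while the characteristic polynomial is decided by A^n x; so both can be
    chosen independently. Concretely, for a cyclic C with the given
    characteristic polynomial, the vectors P_j(C) e_0 are the columns of the
    triangular matrix U of coefficients of the P_j, and conjugating C by the
    matrix T with T U = S moves them onto the columns of S. *)
Lemma exists_mx_prescribed_orbit (K : fieldType) (n : nat) (chi : {poly K})
    (P : nat -> {poly K}) (S : 'M[K]_n.+1) :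
  chi \is monic -> size chi = n.+2 -> P 0%N = 1 ->
  (forall j, (j < n.+1)%N -> size (P j) = j.+1) -> S \in unitmx ->
  exists A : 'M[K]_n.+1, char_poly A = chi /\
    forall j : 'I_n.+1, horner_mx A (P j) *m col 0 S = col j S.
Proof.
move=> chi_monic size_chi P0 size_P S_unit.
have [C [charC shiftC]] := exists_cyclic_mx chi_monic size_chi.
pose U : 'M[K]_n.+1 := \matrix_(i, j) (P j)`_i.
(* U is upper triangular, with the leading coefficients on its diagonal. *)
have U_unit : U \in unitmx.
  rewrite -unitmx_tr unitmxE det_trig; last first.
    by apply/is_trig_mxP => i j lt_ij; rewrite !mxE nth_default ?size_P.
  rewrite unitfE prodf_seq_neq0; apply/allP => i _ /=; rewrite !mxE.
  have size_Pi := size_P _ (ltn_ord i).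
  have -> : (P i)`_i = lead_coef (P i) by rewrite lead_coefE size_Pi.
  by rewrite lead_coef_eq0 -size_poly_eq0 size_Pi.
have PC (j : 'I_n.+1) : horner_mx C (P j) *m delta_mx 0 0 = col j U.
  rewrite horner_cyclic_mx ?size_P //.
  by apply/colP => i; rewrite !mxE.
have colU0 : col 0 U = delta_mx 0 0.
  by rewrite -PC P0 rmorph1 mul1mx.
have [T T_unit TU] : exists2 T : 'M[K]_n.+1, T \in unitmx &
    forall j : 'I_n.+1, T *m col j U = col j S.
  exists (S *m invmx U); first by rewrite unitmx_mul S_unit unitmx_inv.
  by move=> j; rewrite !colE mulmxA mulmxKV.
exists (T *m C *m invmx T); split; first by rewrite char_poly_uconj.
move=> j; rewrite -TU colU0 horner_mx_uconj // -!mulmxA mulKmx // PC.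
exact: TU.
Qed.

(** * Residuals of minimal norm *)

Lemma sqr_enorm (R : realType) (n : nat) (v : 'cV[R[i]]_n) :
  enorm v ^+ 2 = \sum_(i < n) ComplexField.Normc.normc (v i 0) ^+ 2.
Proof. by rewrite sqr_sqrtr // sumr_ge0 // => i _; rewrite sqr_ge0. Qed.

Lemma sqr_enorm_le0 (R : realType) (n : nat) (v : 'cV[R[i]]_n) :
  enorm v ^+ 2 <= 0 -> v = 0.
Proof.
rewrite sqr_enorm => v_le0; apply/colP => i; rewrite mxE.
apply: ComplexField.Normc.eq0_normc; apply/eqP; rewrite -sqrf_eq0.
have sq_ge0 (j : 'I_n) : true -> 0 <= ComplexField.Normc.normc (v j 0) ^+ 2.
  by rewrite sqr_ge0.
have: \sum_(j < n) ComplexField.Normc.normc (v j 0) ^+ 2 == 0.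
  by rewrite eq_le v_le0 sumr_ge0.
by rewrite psumr_eq0 // => /allP/(_ i)/=; apply; rewrite mem_index_enum.
Qed.

Lemma sqr_enormB_disjoint (R : realType) (n : nat) (t w : 'cV[R[i]]_n) :
  (forall i, t i 0 != 0 -> w i 0 = 0) ->
  enorm (t - w) ^+ 2 = enorm t ^+ 2 + enorm w ^+ 2.
Proof.
move=> disj; rewrite !sqr_enorm -big_split /=; apply: eq_bigr => i _.
have normc0 := ComplexField.Normc.normc0 R.
rewrite 2!mxE; have [->|/disj ->] := eqVneq (t i 0) 0.
  by rewrite sub0r normcN normc0 expr0n /= add0r.
by rewrite subr0 normc0 expr0n /= addr0.
Qed.

Lemma krylov_sum (R : realType) (n : nat) (A : 'M[R[i]]_n) (r z : 'cV[R[i]]_n)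
    (j : nat) :
  z \in krylov A r j ->
  exists c : 'I_j -> R[i], z = \sum_(i < j) c i *: (A ^+ i *m r).
Proof.
pose g (i : nat) := A ^+ i *m r.
rewrite /krylov; have /eqP size_s := size_mkseq g j.
move=> /(@coord_span _ _ _ (Tuple size_s)) ->.
exists (fun i => coord (Tuple size_s) i z); apply: eq_bigr => i _.
by rewrite /= nth_mkseq.
Qed.

(** A sufficient condition for t to be the residual after a cycle of length j
    from the residual r: t is attainable and is orthogonal to A K_j(A, r) for
    the simple reason that it has no coordinate in common with A r, ...,
    A^j r. *)
Definition gmres_target (R : realType) (n : nat) (A : 'M[R[i]]_n) (j : nat)
    (r t : 'cV[R[i]]_n) : Prop :=
  (exists2 z, z \in krylov A r j & t = r - A *m z) /\
  forall i : nat, (i < j)%N ->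
    forall l, t l 0 != 0 -> (A ^+ i.+1 *m r) l 0 = 0.

Lemma krylov_image_disjoint (R : realType) (n : nat) (A : 'M[R[i]]_n) (j : nat)
    (r t z : 'cV[R[i]]_n) :
  gmres_target A j r t -> z \in krylov A r j ->
  forall l, t l 0 != 0 -> (A *m z) l 0 = 0.
Proof.
case=> _ disj /krylov_sum [c ->] l tl; rewrite mulmx_sumr summxE big1 // => i _.
by rewrite -scalemxAr mulmxA -[A *m _]/(A * _) -exprS mxE disj ?mulr0.
Qed.

Lemma residualB (R : realType) (n : nat) (A : 'M[R[i]]_n)
    (b x x' : 'cV[R[i]]_n) :
  residual A b x' = residual A b x - A *m (x' - x).
Proof. by rewrite /residual mulmxBr opprB addrA subrK. Qed.

(** Pythagoras: every attainable residual is t - w with w in A K_j(A, r), and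
    t and w have disjoint supports, so its squared norm is that of t plus that
    of w. It is minimal exactly when w = 0. *)
Lemma gmres_cycleP (R : realType) (n : nat) (A : 'M[R[i]]_n) (j : nat)
    (b x x' t : 'cV[R[i]]_n) :
  gmres_target A j (residual A b x) t ->
  gmres_cycle A b j x x' <->
    x' - x \in krylov A (residual A b x) j /\ residual A b x' = t.
Proof.
set r := residual A b x => target; have [[z0 z0K tE] _] := target.
have splitE z : z - x \in krylov A r j ->
    enorm (residual A b z) ^+ 2
      = enorm t ^+ 2 + enorm (A *m (z - x - z0)) ^+ 2.
  move=> zK; rewrite -sqr_enormB_disjoint; last first.
    apply: krylov_image_disjoint target _.
    by rewrite rpredB.
  rewrite (residualB _ _ x) -/r tE -[in LHS](subrK z0 (z - x)) mulmxDr.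
  by rewrite opprD addrA addrAC.
split=> -[x'K x'P]; split=> //.
  pose y := x + z0; have yE : y - x = z0 by rewrite addrC addKr.
  have := x'P y; rewrite yE => /(_ z0K).
  rewrite -(ler_pXn2r (n := 2)) ?nnegrE ?sqrtr_ge0 //.
  rewrite !splitE ?yE // subrr mulmx0.
  have -> : enorm (0 : 'cV[R[i]]_n) ^+ 2 = 0.
    by rewrite sqr_enorm big1 // => i _;
       rewrite mxE ComplexField.Normc.normc0 expr0n.
  rewrite lerD2l => /sqr_enorm_le0 Aw0.
  by rewrite (residualB _ _ x) -/r -[x' - x](subrK z0) mulmxDr Aw0 add0r tE.
move=> z zK; rewrite -(ler_pXn2r (n := 2)) ?nnegrE ?sqrtr_ge0 //.
by rewrite x'P splitE // lerDl sqr_ge0.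
Qed.

(** The iterates need not be unique when A is singular, but the residuals are,
    and each cycle depends on the previous ones only through the residual. *)
Lemma restarted_gmres_targets (R : realType) (n : nat) (A : 'M[R[i]]_n)
    (q : nat) (m : nat -> nat) (t : nat -> 'cV[R[i]]_n) :
  (forall k, (k < q)%N -> gmres_target A (m k.+1) (t k) (t k.+1)) ->
  forall b x0, residual A b x0 = t 0%N ->
  (exists x, restarted_gmres A b x0 q m x) /\
  (forall x, restarted_gmres A b x0 q m x ->
     forall k, (k <= q)%N -> residual A b (x k) = t k).
Proof.
move=> target b x0 r0E; split=> [|x [xE cyc]].
  have /boolp.choice [z zP] : forall k, exists z, (k < q)%N ->
      z \in krylov A (t k) (m k.+1) /\ t k.+1 = t k - A *m z.
    move=> k; have [lt_k|] := ltnP k q; last by exists 0.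
    by have [[z zK tE] _] := target _ lt_k; exists z.
  pose x k := x0 + \sum_(i < k) z i.
  have xB k : x k.+1 - x k = z k.
    have -> : x k.+1 = x k + z k by rewrite /x big_ord_recr addrA.
    by rewrite addrAC subrr add0r.
  have xE k : (k <= q)%N -> residual A b (x k) = t k.
    elim: k => [|k IH] lt_k; first by rewrite /x big_ord0 addr0.
    by rewrite (residualB _ _ (x k)) xB IH ?(ltnW lt_k) //; case: (zP _ lt_k).
  exists x; split=> [|[//|k] /= lt_k]; first by rewrite /x big_ord0 addr0.
  have [zK _] := zP _ lt_k; have rE := xE _ (ltnW lt_k).
  have tgt := target _ lt_k; rewrite -rE in tgt zK.
  by apply/(gmres_cycleP _ tgt); rewrite xB; split=> //; exact: xE.
elim=> [_|k IH lt_k]; first by rewrite xE.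
have tgt := target _ lt_k; rewrite -IH ?(ltnW lt_k) // in tgt.
by have /(gmres_cycleP _ tgt)[] := cyc k.+1 lt_k.
Qed.

(** * Positions and cycles *)

Definition cycle_start (m : nat -> nat) (k : nat) : nat :=
  \sum_(1 <= i < k.+1) m i.

(** The number of cycles k >= 0 that start before position j. The recursion
    uses that the starts increase: once c of them have been passed, the next
    one is [cycle_start m c]. In particular j is the start of a cycle exactly
    when j = [cycle_start m (cycles_before m j)]. *)
Fixpoint cycles_before (m : nat -> nat) (j : nat) : nat :=
  if j is j'.+1 then
    (cycles_before m j' + (j' == cycle_start m (cycles_before m j')))%N
  else 0%N.

Lemma cycle_start0 (m : nat -> nat) : cycle_start m 0 = 0%N.
Proof. by rewrite /cycle_start big_geq. Qed.

Lemma cycle_startS (m : nat -> nat) (k : nat) :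
  cycle_start m k.+1 = (cycle_start m k + m k.+1)%N.
Proof. by rewrite /cycle_start big_nat_recr. Qed.

Lemma leq_cycle_start (m : nat -> nat) (k l : nat) :
  (k <= l)%N -> (cycle_start m k <= cycle_start m l)%N.
Proof.
move=> /subnKC <-; elim: (l - k)%N => [|d IH]; first by rewrite addn0.
by rewrite addnS cycle_startS (leq_trans IH) ?leq_addr.
Qed.

Lemma cycles_beforeE (m : nat -> nat) (k j : nat) :
  (forall k, 0 < m k.+1)%N -> (cycle_start m k < j <= cycle_start m k.+1)%N ->
  cycles_before m j = k.+1.
Proof.
move=> m_gt0; elim: j k => [//|j IH] k /andP[]; rewrite ltnS leq_eqVlt /=.
case/orP=> [/eqP kj _|lt_kj lt_jk]; last first.
  by rewrite (IH k) ?lt_kj ?(ltnW lt_jk) // ltn_eqF ?addn0.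
suff -> : cycles_before m j = k by rewrite kj eqxx addn1.
case: k kj => [|k] jE; first by rewrite -jE cycle_start0.
apply: IH; rewrite -jE leqnn andbT cycle_startS.
by rewrite -[X in (X < _)%N]addn0 ltn_add2l.
Qed.

Lemma cycles_before_start (m : nat -> nat) (k : nat) :
  (forall k, 0 < m k.+1)%N -> cycles_before m (cycle_start m k) = k.
Proof.
move=> m_gt0; case: k => [|k]; first by rewrite cycle_start0.
apply: cycles_beforeE => //.
by rewrite leqnn andbT cycle_startS -[X in (X < _)%N]addn0 ltn_add2l.
Qed.

Lemma cycle_decomposition (m : nat -> nat) (j : nat) :
  (forall k, 0 < m k.+1)%N ->
  exists k i, (i < m k.+1)%N /\ j = (cycle_start m k + i)%N.
Proof.
move=> m_gt0; elim: j => [|j [k [i [lt_i ->]]]].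
  by exists 0%N, 0%N; rewrite cycle_start0.
have [eq_i|lt_i'] := eqVneq i.+1 (m k.+1); last first.
  by exists k, i.+1; rewrite addnS ltn_neqAle lt_i'.
by exists k.+1, 0%N; rewrite addn0 cycle_startS -eq_i addnS.
Qed.

(** The residual polynomial reached after k cycles. *)
Definition cycle_poly (K : nzRingType) (m : nat -> nat) (k : nat) : {poly K} :=
  \prod_(1 <= i < k.+1) (1 - 'X^(m i)).

Lemma cycle_polyS (K : nzRingType) (m : nat -> nat) (k : nat) :
  cycle_poly K m k.+1 = cycle_poly K m k * (1 - 'X^(m k.+1)).
Proof. by rewrite /cycle_poly big_nat_recr. Qed.

Lemma size_cycle_poly (K : fieldType) (m : nat -> nat) (k : nat) :
  (forall k, 0 < m k.+1)%N ->
  size (cycle_poly K m k) = (cycle_start m k).+1.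
Proof.
move=> m_gt0; elim: k => [|k IH].
  by rewrite /cycle_poly big_geq // size_poly1 cycle_start0.
rewrite cycle_polyS cycle_startS.
have sizeE : size (1 - 'X^(m k.+1) : {poly K}) = (m k.+1).+1.
  by rewrite -size_polyN opprB size_XnsubC.
by rewrite size_mul ?IH ?sizeE ?addnS // -size_poly_gt0 ?IH ?sizeE.
Qed.

(** The polynomial X^(j - M k) D_k of degree j, where k is the cycle, counted
    from 0, to which position j belongs. *)
Definition position_poly (K : nzRingType) (m : nat -> nat) (j : nat) :
    {poly K} :=
  let k := (cycles_before m j.+1).-1 in
  'X^(j - cycle_start m k) * cycle_poly K m k.

Lemma position_polyE (K : nzRingType) (m : nat -> nat) (k i : nat) :
  (forall k, 0 < m k.+1)%N -> (i < m k.+1)%N ->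
  position_poly K m (cycle_start m k + i) = 'X^i * cycle_poly K m k.
Proof.
move=> m_gt0 lt_i; rewrite /position_poly (@cycles_beforeE _ k) //=.
  by rewrite addKn.
by rewrite ltnS leq_addr cycle_startS ltn_add2l.
Qed.

Lemma size_position_poly (K : fieldType) (m : nat -> nat) (j : nat) :
  (forall k, 0 < m k.+1)%N -> size (position_poly K m j) = j.+1.
Proof.
move=> m_gt0; have [k [i [lt_i ->]]] := cycle_decomposition j m_gt0.
have sizeD := size_cycle_poly K k m_gt0.
rewrite position_polyE // size_mul ?sizeD ?size_polyXn ?addSn ?addnS 1?addnC //.
  by rewrite -size_poly_gt0 size_polyXn.
by rewrite -size_poly_gt0 sizeD.
Qed.

(** * The target residuals *)

(** The difference vanishes unless j is the start of a cycle, and it telescopes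
    over any range of positions. *)
Definition position_weight (R : rcfType) (m : nat -> nat) (F : nat -> R)
    (j : nat) : R :=
  Num.sqrt (F (cycles_before m j) ^+ 2 - F (cycles_before m j.+1) ^+ 2).

Definition tail_vector (R : rcfType) (m : nat -> nat) (F : nat -> R)
    (n k : nat) : 'cV[R[i]]_n :=
  \col_j if (cycle_start m k <= j)%N then (position_weight m F j)%:C%C else 0.

Lemma enorm_tail_vector (R : realType) (m : nat -> nat) (F : nat -> R)
    (n p k : nat) :
  (forall k, 0 < m k.+1)%N -> (forall k, 0 <= F k) ->
  (forall k, F k.+1 <= F k) -> F p.+1 = 0 ->
  (cycle_start m p < n <= cycle_start m p.+1)%N -> (k <= p)%N ->
  enorm (tail_vector m F n k) = F k.
Proof.
move=> m_gt0 F_ge0 F_dec F0 n_bd le_kp.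
apply: (pexpIrn (n := 2)); rewrite ?nnegrE ?sqrtr_ge0 // sqr_enorm.
(* The sign makes the squared weights the increments of h. *)
pose h j := - F (cycles_before m j) ^+ 2.
have termE (j : 'I_n) : true ->
    ComplexField.Normc.normc (tail_vector m F n k j 0) ^+ 2 =
    if (cycle_start m k <= j)%N then h j.+1 - h j else 0.
  move=> _; rewrite mxE; case: ifP => _; last first.
    by rewrite ComplexField.Normc.normc0 expr0n.
  rewrite /= expr0n /= addr0 sqrtr_sqr real_normK ?num_real //.
  rewrite sqr_sqrtr /h ?opprK 1?addrC // addrC subr_ge0.
  rewrite ler_pXn2r ?nnegrE //=.
  by case: eqP => _; rewrite ?addn0 ?addn1.
rewrite (eq_bigr _ termE) -big_mkcond /=.
have lt_kn : (cycle_start m k < n)%N.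
  case/andP: n_bd => lt_pn _; apply: leq_ltn_trans lt_pn.
  exact: leq_cycle_start.
rewrite -(big_geq_mkord _ _ xpredT (fun j => h j.+1 - h j)).
rewrite telescope_sumr ?(ltnW lt_kn) // /h cycles_before_start //.
by rewrite (@cycles_beforeE _ p) // F0 expr0n oppr0 add0r opprK.
Qed.

(** The basis on which the orbit is prescribed: the target residuals at the
    starts of cycles and unit vectors elsewhere. *)
Definition position_mx (R : rcfType) (m : nat -> nat) (F : nat -> R)
    (n : nat) : 'M[R[i]]_n :=
  \matrix_(i, j) if (j : nat) == cycle_start m (cycles_before m j)
    then tail_vector m F n (cycles_before m j) i 0 else (i == j)%:R.

Lemma col_position_mx_start (R : rcfType) (m : nat -> nat) (F : nat -> R)
    (n k : nat) (j : 'I_n) :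
  (forall k, 0 < m k.+1)%N -> j = cycle_start m k :> nat ->
  col j (position_mx m F n) = tail_vector m F n k.
Proof.
move=> m_gt0 jE; apply/colP => i; rewrite [in LHS]mxE [in LHS]mxE jE.
by rewrite cycles_before_start // eqxx.
Qed.

Lemma col_position_mx_inner (R : rcfType) (m : nat -> nat) (F : nat -> R)
    (n k : nat) (j : 'I_n) :
  (forall k, 0 < m k.+1)%N ->
  (cycle_start m k < j < cycle_start m k.+1)%N ->
  col j (position_mx m F n) = delta_mx j 0.
Proof.
move=> m_gt0 /andP[lt_kj lt_jk]; apply/colP => i; rewrite !mxE.
by rewrite (@cycles_beforeE _ k) ?lt_kj ?(ltnW lt_jk) // ltn_eqF // andbT.
Qed.

(** The matrix is lower triangular; the diagonal entry at the start of cycle k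
    is the square root of F k ^ 2 - F k.+1 ^ 2, so the strict decrease of F
    makes it invertible. *)
Lemma position_mx_unit (R : realType) (m : nat -> nat) (F : nat -> R)
    (n p : nat) :
  (forall k, 0 < m k.+1)%N -> (forall k, 0 <= F k) ->
  (forall k, (k <= p)%N -> F k.+1 < F k) ->
  (n <= cycle_start m p.+1)%N -> position_mx m F n \in unitmx.
Proof.
move=> m_gt0 F_ge0 F_dec n_le; rewrite unitmxE det_trig; last first.
  apply/is_trig_mxP => i j lt_ij; rewrite !mxE; case: eqP => [<-|_].
    by rewrite leqNgt lt_ij.
  by rewrite -val_eqE ltn_eqF.
rewrite unitfE prodf_seq_neq0; apply/allP => j _ /=; rewrite !mxE.
case: ifP => [/eqP jE|_]; last by rewrite eqxx oner_eq0.
rewrite -jE leqnn /position_weight /= -jE eqxx addn1.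
have le_cp : (cycles_before m j <= p)%N.
  rewrite leqNgt; apply/negP => /(leq_cycle_start m); rewrite -jE.
  by rewrite leqNgt (leq_trans (ltn_ord j)).
rewrite eq_complex /= eqxx andbT gt_eqF // sqrtr_gt0 subr_gt0.
by rewrite ltr_pXn2r ?nnegrE ?F_dec.
Qed.

(** * Prescribing the residuals *)

(** The orbit of each target residual within its own cycle: it visits unit
    vectors, and its last step produces the next target residual. *)
Definition restarts_along_tails (R : rcfType) (m : nat -> nat) (F : nat -> R)
    (n : nat) (A : 'M[R[i]]_n) : Prop :=
  (forall k i (j : 'I_n), (0 < i < m k.+1)%N ->
     j = (cycle_start m k + i)%N :> nat ->
     A ^+ i *m tail_vector m F n k = delta_mx j 0) /\
  (forall k, (cycle_start m k.+1 < n)%N ->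
     A ^+ m k.+1 *m tail_vector m F n k
       = tail_vector m F n k - tail_vector m F n k.+1).

(** The last relation of [restarts_along_tails] comes from the factorization
    D_(k+1) = D_k (1 - X^(m k.+1)), that is, X^(m k.+1) D_k = D_k - D_(k+1). *)
Lemma exists_restart_mx (R : realType) (m : nat -> nat) (F : nat -> R)
    (n p : nat) (chi : {poly R[i]}) :
  (forall k, 0 < m k.+1)%N -> (forall k, 0 <= F k) ->
  (forall k, (k <= p)%N -> F k.+1 < F k) ->
  (n.+1 <= cycle_start m p.+1)%N ->
  chi \is monic -> size chi = n.+2 ->
  exists A : 'M[R[i]]_n.+1, char_poly A = chi /\ restarts_along_tails m F A.
Proof.
move=> m_gt0 F_ge0 F_dec n_le chi_monic size_chi.
have P0 : position_poly R[i] m 0 = 1.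
  have := @position_polyE R[i] m 0 0 m_gt0 (m_gt0 0%N).
  by rewrite cycle_start0 => ->; rewrite /cycle_poly big_geq // expr0 mulr1.
have [A [charA orbitA]] := exists_mx_prescribed_orbit chi_monic size_chi P0
  (fun j _ => size_position_poly R[i] j m_gt0)
  (position_mx_unit m_gt0 F_ge0 F_dec n_le).
set S := position_mx m F n.+1 in orbitA.
pose t k := tail_vector m F n.+1 k.
have t0 : col 0 S = t 0%N.
  by apply: col_position_mx_start; rewrite ?cycle_start0.
have DA k : (cycle_start m k < n.+1)%N ->
    horner_mx A (cycle_poly _ m k) *m t 0%N = t k.
  move=> lt_k; have := orbitA (Ordinal lt_k).
  rewrite t0 (@col_position_mx_start _ _ _ _ k) // -/(t k) => <-.
  have := @position_polyE R[i] m k 0 m_gt0 (m_gt0 k).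
  by rewrite addn0 /= => ->; rewrite expr0 mul1r.
have powA k i : (cycle_start m k < n.+1)%N -> A ^+ i *m t k =
    horner_mx A ('X^i * cycle_poly _ m k) *m t 0%N.
  by move=> lt_k; rewrite -(DA k) // rmorphM rmorphXn /= horner_mx_X mulmxA.
exists A; split=> //; split=> [k i j /andP[i_gt0 lt_i] jE|k lt_k].
  have lt_k : (cycle_start m k < n.+1)%N.
    by rewrite (leq_ltn_trans _ (ltn_ord j)) // jE leq_addr.
  rewrite -/(t k) powA // -(position_polyE _ m_gt0) // -jE -t0 orbitA.
  apply: (@col_position_mx_inner _ _ _ _ k) => //.
  rewrite jE cycle_startS ltn_add2l lt_i.
  by rewrite -[X in (X < _)%N]addn0 ltn_add2l i_gt0.
have lt_k' : (cycle_start m k < n.+1)%N.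
  by rewrite (leq_ltn_trans _ lt_k) // cycle_startS leq_addr.
rewrite -/(t k) -/(t k.+1) powA // -(DA k.+1) // -(DA k) //.
rewrite cycle_polyS mulrBr mulr1 rmorphB /= mulmxBl opprB addrC subrK.
by rewrite mulrC.
Qed.

(** The vectors A tail k, ..., A^(m k.+1) tail k live on the positions of the
    cycle that starts at M k, and tail k.+1 on later positions. *)
Lemma gmres_target_descent (R : realType) (m : nat -> nat) (F : nat -> R)
    (n k : nat) (A : 'M[R[i]]_n.+1) :
  (forall k, 0 < m k.+1)%N ->
  restarts_along_tails m F A ->
  (cycle_start m k.+1 < n.+1)%N ->
  gmres_target A (m k.+1) (tail_vector m F n.+1 k) (tail_vector m F n.+1 k.+1).
Proof.
move=> m_gt0 [inner last] lt_k; split.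
  (* A maps this vector to tail k - tail k.+1. *)
  exists (A ^+ (m k.+1).-1 *m tail_vector m F n.+1 k).
    by apply/memv_span/mapP; exists (m k.+1).-1; rewrite // mem_iota /= prednK.
  rewrite mulmxA -[A *m _]/(A * _) -exprS prednK // last // opprB.
  by rewrite addrC subrK.
move=> i lt_i l; rewrite [X in X != _]mxE.
case: leqP => [le_kl _|_]; last by rewrite eqxx.
have [eq_i|neq_i] := eqVneq i.+1 (m k.+1).
  rewrite eq_i last // !mxE le_kl.
  by rewrite (leq_trans (leq_cycle_start m (leqnSn k))) ?subrr.
have lt_i' : (i.+1 < m k.+1)%N by rewrite ltn_neqAle neq_i.
have lt_j : (cycle_start m k + i.+1 < n.+1)%N.
  by rewrite (ltn_trans _ lt_k) // cycle_startS ltn_add2l.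
rewrite (inner k i.+1 (Ordinal lt_j)) // mxE -val_eqE /= gtn_eqF //.
by rewrite (leq_trans _ le_kl) // cycle_startS ltn_add2l.
Qed.

(** As F p.+1 = 0 and M p.+1 lies beyond the last position, the only nonzero
    entry of tail p is the one at M p, which A tail p, ..., A^d tail p avoid. *)
Lemma gmres_target_stagnation (R : realType) (m : nat -> nat) (F : nat -> R)
    (n p d : nat) (A : 'M[R[i]]_n.+1) :
  (forall k, 0 < m k.+1)%N ->
  restarts_along_tails m F A ->
  F p.+1 = 0 -> (n.+1 <= cycle_start m p.+1)%N ->
  (cycle_start m p + d < n.+1)%N ->
  gmres_target A d (tail_vector m F n.+1 p) (tail_vector m F n.+1 p).
Proof.
move=> m_gt0 [inner _] F0 n_le lt_d; split.
  by exists 0; rewrite ?mem0v // mulmx0 subr0.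
move=> i lt_i l; rewrite [X in X != _]mxE leq_eqVlt.
case: (eqVneq (cycle_start m p) l) => [lE _|_] /=.
  have lt_j : (cycle_start m p + i.+1 < n.+1)%N.
    by rewrite (leq_ltn_trans _ lt_d) // leq_add2l.
  rewrite (inner p i.+1 (Ordinal lt_j)) //.
    by rewrite mxE -val_eqE /= -lE addnS ltn_eqF // ltnS leq_addr.
  by rewrite -(ltn_add2l (cycle_start m p) i.+1) -cycle_startS (leq_trans lt_j).
case: ifP => [lt_pl|_]; last by rewrite eqxx.
have lt_l := leq_trans (ltn_ord l) n_le.
rewrite /position_weight !(@cycles_beforeE _ p) // ?lt_pl ?(ltnW lt_l) //.
  by rewrite subrr sqrtr0 eqxx.
by rewrite ltnS (ltnW lt_pl).
Qed.

(** The two admissible shapes of f become one: strict decrease up to some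
    p <= q and constancy afterwards. *)
Lemma admissible_descent_length (R : realType) (q : nat) (f : nat -> R) :
  (forall k : nat, (k < q)%N -> f k.+1 < f k) \/
  (exists s : nat, [/\ (s < q)%N,
     forall k : nat, (k < s)%N -> f k.+1 < f k &
     forall k : nat, (s <= k <= q)%N -> f k = f s]) ->
  exists p : nat, [/\ (p <= q)%N,
     forall k : nat, (k < p)%N -> f k.+1 < f k &
     forall k : nat, (k <= q)%N -> f k = f (minn k p)].
Proof.
case=> [dec|[s [lt_sq dec const]]].
  by exists q; split=> // k /minn_idPl ->.
exists s; split=> [|//|k le_kq]; first exact: ltnW.
have [//|le_sk] := leqP k s.
by apply: const; rewrite (ltnW le_sk).
Qed.

Theorem corollary1 (R : realType) (n q : nat) (m : nat -> nat) (f : nat -> R)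
    (lambda : 'I_n -> R[i])
    (n_gt0 : (0 < n)%N) (q_gt0 : (0 < q)%N)
    (m_bounds : forall k : nat, (1 <= k <= q)%N -> (1 <= m k <= n - 1)%N)
    (m_sum : (\sum_(1 <= k < q.+1) m k < n)%N)
    (f_gt0 : forall k : nat, (k <= q)%N -> 0 < f k)
    (f_adm : (forall k : nat, (k < q)%N -> f k.+1 < f k) \/
             (exists s : nat, [/\ (s < q)%N,
                forall k : nat, (k < s)%N -> f k.+1 < f k &
                forall k : nat, (s <= k <= q)%N -> f k = f s]))
    (lambda_neq0 : forall i : 'I_n, lambda i != 0) :
  exists (A : 'M[R[i]]_n) (r0 : 'cV[R[i]]_n),
    [/\ char_poly A = \prod_(i < n) ('X - (lambda i)%:P),
        enorm r0 = f 0%N &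
        forall b x0 : 'cV[R[i]]_n, residual A b x0 = r0 ->
          (exists x : nat -> 'cV[R[i]]_n, restarted_gmres A b x0 q m x) /\
          (forall x : nat -> 'cV[R[i]]_n, restarted_gmres A b x0 q m x ->
             forall k : nat, (1 <= k <= q)%N ->
               enorm (residual A b (x k)) = f k)].
Proof.
case: n => [//|n] in lambda n_gt0 m_bounds m_sum lambda_neq0 *.
have [p [le_pq dec fE]] := admissible_descent_length f_adm.
(* The cycle after the descent is made to fill all the remaining positions,
   and the weight at its start to carry all of the remaining norm. *)
pose m' k := if (k <= p)%N then m k else n.+1.
pose F k := if (k <= p)%N then f k else 0.
have m'_gt0 k : (0 < m' k.+1)%N.
  rewrite /m'; case: ifP => // lt_kp.
  by case/andP: (m_bounds k.+1 (leq_trans lt_kp le_pq)).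
have start_m' k : (k <= p)%N -> cycle_start m' k = cycle_start m k.
  move=> le_kp; apply: eq_big_nat => i /andP[_ lt_ik].
  by rewrite /m' (leq_trans _ le_kp).
have F_ge0 k : 0 <= F k.
  by rewrite /F; case: ifP => // le_kp; rewrite ltW // f_gt0 ?(leq_trans le_kp).
have F_dec k : (k <= p)%N -> F k.+1 < F k.
  move=> le_kp; rewrite /F le_kp; case: ifP => [/dec //|_].
  by rewrite f_gt0 ?(leq_trans le_kp).
have F0 : F p.+1 = 0 by rewrite /F ltnn.
have F_noninc k : F k.+1 <= F k.
  have [/F_dec/ltW //|lt_pk] := leqP k p.
  by rewrite /F !ifN // -ltnNge // ltnS ltnW.
have start_lt k : (p <= k)%N -> (k < q)%N ->
    (cycle_start m p + m k.+1 < n.+1)%N.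
  move=> le_pk lt_kq; apply: leq_ltn_trans m_sum.
  apply: (@leq_trans (cycle_start m k.+1)); last exact: leq_cycle_start.
  by rewrite cycle_startS leq_add2r leq_cycle_start.
have start_p : (cycle_start m p < n.+1)%N.
  by apply: leq_ltn_trans m_sum; apply: leq_cycle_start.
have n_le : (n.+1 <= cycle_start m' p.+1)%N.
  by rewrite cycle_startS {2}/m' ltnn leq_addl.
pose chi := \prod_(i < n.+1) ('X - (lambda i)%:P).
have chi_monic : chi \is monic by apply: monic_prod_XsubC.
have size_chi : size chi = n.+2.
  by rewrite size_prod_XsubC [index_enum _]unlock -enumT size_enum_ord.
have [A [charA tailsA]] :=
  exists_restart_mx m'_gt0 F_ge0 F_dec n_le chi_monic size_chi.
pose t k := tail_vector m' F n.+1 (minn k p).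
have enorm_t k : (k <= q)%N -> enorm (t k) = f k.
  move=> le_kq; rewrite (@enorm_tail_vector _ _ _ _ p) ?geq_minr //.
    by rewrite /F geq_minr -fE.
  by rewrite start_m' // start_p.
exists A, (t 0%N); split=> // [|b x0 r0E]; first exact: enorm_t.
have target k : (k < q)%N -> gmres_target A (m k.+1) (t k) (t k.+1).
  move=> lt_kq; rewrite /t; have [le_pk|lt_kp] := leqP p k.
    rewrite !(minn_idPr _) // ?(leqW le_pk) //.
    apply: gmres_target_stagnation => //.
    by rewrite start_m' // start_lt.
  rewrite !(minn_idPl _) // ?(ltnW lt_kp) //.
  have <- : m' k.+1 = m k.+1 by rewrite /m' lt_kp.
  have lt_k : (cycle_start m' k.+1 < n.+1)%N.
    by rewrite start_m' // (leq_ltn_trans _ start_p) // leq_cycle_start.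
  exact: gmres_target_descent.
have [exist unique] := restarted_gmres_targets target r0E.
split=> // x xP k /andP[_ le_kq].
by rewrite (unique x xP) // enorm_t.
Qed.
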